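(* Let $x_1,\ldots,x_n$ be real numbers, and let $r>0$ satisfy $$\min_{1\le p\le n} r x_p^{2}\ \ge\ \max_{1\le q\le n} x_q^{2}.$$ Then $$\operatorname{st}_{+}\big(A(x_1,\ldots,x_n,r x_1,\ldots,r x_n)\big)\le \operatorname{st}_{+}\big(A(x_1,\ldots,x_n)\big)+4.$$
   Context: For real numbers $z_1,\ldots,z_m$, the associated Euclidean distance matrix is the $m\times m$ symmetric nonnegative matrix $A(z_1,\ldots,z_m):=\big(|z_i-z_j|^2\big)_{i,j=1}^m$. Here $\mathbb{R}_{+}^{m\times n}$ is the set of $m\times n$ real matrices with nonnegative entries and $\mathcal{S}_n^{+}$ is the set of symmetric $n\times n$ matrices with nonnegative entries. For $A\in\mathcal{S}_n^{+}$, an SN-Trifactorization of $A$ is a factorization $A=BCB^{T}$ with $B\in\mathbb{R}_{+}^{n\times k}$ and $C\in\mathcal{S}_k^{+}$; the SNT-rank $\operatorname{st}_{+}(A)$ is the smallest integer $k$ for which such a factorization exists, with the convention $\operatorname{st}_{+}(0)=0$. *)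

(* Defs.v *)
From mathcomp Require Import all_boot all_order all_algebra.
From mathcomp Require Import boolp reals.

Set Implicit Arguments.
Unset Strict Implicit.
Unset Printing Implicit Defensive.

Import Order.TTheory GRing.Theory Num.Theory.
Local Open Scope ring_scope.

(* The points z_1, ..., z_m are the entries of a row vector. *)
Definition edm (R : realType) (m : nat) (z : 'rV[R]_m) : 'M[R]_m :=
  \matrix_(i, j) `|z 0 i - z 0 j| ^+ 2.

Definition symnneg (R : realType) (n : nat) (A : 'M[R]_n) : Prop :=
  A^T = A /\ A \is a mxOver Num.nneg.

Definition is_snt (R : realType) (n k : nat) (A : 'M[R]_n)
    (B : 'M[R]_(n, k)) (C : 'M[R]_k) : Prop :=
  [/\ B \is a mxOver Num.nneg, symnneg C & A = B *m C *m B^T].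

Definition has_snt (R : realType) (n : nat) (A : 'M[R]_n) (k : nat) : Prop :=
  exists (B : 'M[R]_(n, k)) (C : 'M[R]_k), is_snt A B C.

(* The default value 0 is only used for matrices without any factorization,
   which by [has_snt_dim] cannot satisfy [symnneg].  Inner dimension k = 0 is
   allowed, so the convention st_+(0) = 0 holds: see [snt_rank0]. *)
Definition snt_rank (R : realType) (n : nat) (A : 'M[R]_n) : nat :=
  match pselect (exists k, `[< has_snt A k >]) with
  | left ex => ex_minn ex
  | right _ => 0%N
  end.

Lemma has_snt_dim (R : realType) (n : nat) (A : 'M[R]_n) :
  symnneg A -> has_snt A n.
Proof.
move=> sA; exists 1%:M, A; split; rewrite ?trmx1 ?mulmx1 ?mul1mx //.
by apply/mxOverP => i j; rewrite mxE nnegrE ler0n.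
Qed.

Lemma snt_rank_has (R : realType) (n : nat) (A : 'M[R]_n) :
  symnneg A -> has_snt A (snt_rank A).
Proof.
move=> sA; rewrite /snt_rank; case: pselect => [ex|[]].
  by case: ex_minnP => k /asboolP.
by exists n; apply/asboolP/has_snt_dim.
Qed.

Lemma snt_rank_le (R : realType) (n k : nat) (A : 'M[R]_n) :
  has_snt A k -> (snt_rank A <= k)%N.
Proof.
move=> Ak; rewrite /snt_rank; case: pselect => // ex.
by case: ex_minnP => m _; apply; apply/asboolP.
Qed.

Lemma snt_rank0 (R : realType) (n : nat) : snt_rank (0 : 'M[R]_n) = 0%N.
Proof.
apply/eqP; rewrite -leqn0; apply: snt_rank_le; exists 0, 0; split.
- exact: thinmxOver.
- by split; [rewrite trmx0 | exact: thinmxOver].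
- by rewrite mulmx0 mul0mx.
Qed.

Lemma edm_symnneg (R : realType) (m : nat) (z : 'rV[R]_m) : symnneg (edm z).
Proof.
split; first by apply/matrixP => i j; rewrite !mxE distrC.
by apply/mxOverP => i j; rewrite mxE nnegrE exprn_ge0.
Qed.

(* Main.v *)
(** Write A = A(x). For r >= 1 the off-diagonal block of the big matrix satisfies
    (x_i - r x_j)^2 = r A_ij + (r - 1) (r x_j^2 - x_i^2).
    So the big matrix is [1; r] A [1, r], of rank at most st_+(A), plus the
    antidiagonal block matrix with blocks E and E^T, where
    E_ij = (r - 1) (r x_j^2 - x_i^2).  With m = max_q x_q^2, the splitting
    E_ij = (m - x_i^2) (r - 1) + 1 * ((r - 1) (r x_j^2 - m)) is a nonnegative
    factorization of inner dimension 2, which gives one of inner dimension 4 for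
    the antidiagonal part.  If r < 1, the hypothesis forces x = 0. *)

Require Import Defs.
From mathcomp Require Import all_boot all_order all_algebra.
From mathcomp Require Import boolp reals.
From mathcomp Require Import ring lra.

Set Implicit Arguments.
Unset Strict Implicit.
Unset Printing Implicit Defensive.

Import Order.TTheory GRing.Theory Num.Theory.
Local Open Scope ring_scope.

Lemma row_mx_over (T : Type) (S : {pred T}) (m n1 n2 : nat)
    (A : 'M[T]_(m, n1)) (B : 'M[T]_(m, n2)) :
  A \is a mxOver S -> B \is a mxOver S -> row_mx A B \is a mxOver S.
Proof.
move=> /mxOverP sA /mxOverP sB; apply/mxOverP => i j.
by rewrite mxE; case: split.
Qed.

Lemma col_mx_over (T : Type) (S : {pred T}) (m1 m2 n : nat)
    (A : 'M[T]_(m1, n)) (B : 'M[T]_(m2, n)) :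
  A \is a mxOver S -> B \is a mxOver S -> col_mx A B \is a mxOver S.
Proof.
move=> /mxOverP sA /mxOverP sB; apply/mxOverP => i j.
by rewrite mxE; case: split.
Qed.

Lemma block_mx_over (T : Type) (S : {pred T}) (m1 m2 n1 n2 : nat)
    (A : 'M[T]_(m1, n1)) (B : 'M[T]_(m1, n2))
    (C : 'M[T]_(m2, n1)) (D : 'M[T]_(m2, n2)) :
  A \is a mxOver S -> B \is a mxOver S -> C \is a mxOver S ->
  D \is a mxOver S -> block_mx A B C D \is a mxOver S.
Proof. by move=> sA sB sC sD; apply: col_mx_over; apply: row_mx_over. Qed.

(** Juxtapose the outer factors and take the block-diagonal sum of the cores; the cross terms
    vanish. *)
Lemma has_snt_add (R : realType) (n k l : nat) (M N : 'M[R]_n) :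
  has_snt M k -> has_snt N l -> has_snt (M + N) (k + l).
Proof.
move=> [B [C [Bge0 [symC Cge0] ->]]] [B' [C' [B'ge0 [symC' C'ge0] ->]]].
exists (row_mx B B'), (block_mx C 0 0 C'); split.
- exact: row_mx_over.
- split; first by rewrite tr_block_mx !trmx0 symC symC'.
  by apply: block_mx_over; rewrite ?mxOver0 ?rpred0.
- by rewrite mul_row_block !mulmx0 addr0 add0r tr_row_mx mul_row_col.
Qed.

Lemma has_snt_congr (R : realType) (m n k : nat) (P : 'M[R]_(m, n))
    (M : 'M[R]_n) :
  P \is a mxOver Num.nneg -> has_snt M k -> has_snt (P *m M *m P^T) k.
Proof.
move=> Pge0 [B [C [Bge0 sC ->]]]; exists (P *m B), C; split=> //.
- exact: mxOverM.
- by rewrite trmx_mul !mulmxA.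
Qed.

(** The outer factor is diag(U, V); the core swaps the two copies of the inner space, which moves
    the products off the diagonal. *)
Lemma has_snt_antidiag (R : realType) (m n k : nat) (U : 'M[R]_(m, k))
    (V : 'M[R]_(n, k)) :
  U \is a mxOver Num.nneg -> V \is a mxOver Num.nneg ->
  has_snt (block_mx 0 (U *m V^T) (V *m U^T) 0) (k + k).
Proof.
move=> Uge0 Vge0.
have ge0_1 : (1%:M : 'M[R]_k) \is a mxOver Num.nneg.
  by apply/mxOverP => i j; rewrite mxE nnegrE ler0n.
exists (block_mx U 0 0 V), (block_mx 0 1%:M 1%:M 0); split.
- by apply: block_mx_over; rewrite ?mxOver0 ?rpred0.
- split; first by rewrite tr_block_mx !trmx0 !trmx1.
  by apply: block_mx_over; rewrite ?mxOver0 ?rpred0.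
- rewrite tr_block_mx !trmx0 !mulmx_block.
  by rewrite !(mulmx0, mul0mx, mulmx1, addr0, add0r).
Qed.

Lemma edmE (R : realType) (m : nat) (z : 'rV[R]_m) (i j : 'I_m) :
  edm z i j = (z 0 i - z 0 j) ^+ 2.
Proof. by rewrite mxE real_normK ?num_real. Qed.

(** A polynomial identity, valid for all real [r] and [m]: in [U *m V^T] the terms in [m] cancel.
    Signs matter only when it is applied. *)
Lemma edm_dilation (R : realType) (n : nat) (x : 'rV[R]_n) (r m : R) :
  let U : 'M[R]_(n, 1 + 1) :=
    row_mx (\col_i (m - x 0 i ^+ 2)) (const_mx 1) in
  let V : 'M[R]_(n, 1 + 1) :=
    row_mx (const_mx (r - 1)) (\col_j ((r - 1) * (r * x 0 j ^+ 2 - m))) in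
  let P := col_mx 1%:M r%:M in
  edm (row_mx x (r *: x)) =
    P *m edm x *m P^T + block_mx 0 (U *m V^T) (V *m U^T) 0.
Proof.
move=> U V P.
have UV i j : (U *m V^T) i j = (r - 1) * (r * x 0 j ^+ 2 - x 0 i ^+ 2).
  rewrite tr_row_mx mul_row_col !mxE !big_ord1 !mxE; ring.
have VU : V *m U^T = (U *m V^T)^T by rewrite trmx_mul trmxK.
rewrite mul_col_mx mul1mx mul_scalar_mx tr_col_mx mul_col_row trmx1.
rewrite !mulmx1 tr_scalar_mx !mul_mx_scalar VU add_block_mx !addr0.
apply/matrixP => i j; rewrite edmE.
case: (split_ordP i) => {}i ->; case: (split_ordP j) => {}j ->.
- by rewrite block_mxEul edmE !row_mxEl.
- rewrite block_mxEur row_mxEl row_mxEr [RHS]mxE UV 2!mxE edmE; ring.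
- rewrite block_mxEdl row_mxEl row_mxEr [RHS]mxE [_^T _ _]mxE UV 2!mxE edmE.
  ring.
- rewrite block_mxEdr !row_mxEr 4!mxE edmE; ring.
Qed.

Theorem theorem4p6 (R : realType) (n : nat) (hn : (0 < n)%N)
    (x : 'rV[R]_n) (r : R) (hr : 0 < r)
    (hx : forall p q : 'I_n, x 0 q ^+ 2 <= r * x 0 p ^+ 2) :
  (snt_rank (edm (row_mx x (r *: x))) <= snt_rank (edm x) + 4)%N.
Proof.
have [r_ge1|r_lt1] := leP 1 r; last first.
  have x0 : x = 0.
    apply/rowP => i; rewrite mxE; apply/eqP; rewrite -sqrf_eq0.
    (* Taking p = q = i gives (1 - r) x_i^2 <= 0 with 1 - r > 0. *)
    have := hx i i; have := sqr_ge0 (x 0 i).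
    by move=> h1 h2; apply/eqP; nra.
  suff -> : edm (row_mx x (r *: x)) = 0 by rewrite snt_rank0.
  rewrite x0 scaler0 row_mx0; apply/matrixP => i j.
  by rewrite !mxE subrr normr0 expr0n.
have [m m_max m_min] : exists2 m : R,
    (forall i, x 0 i ^+ 2 <= m) & (forall i, m <= r * x 0 i ^+ 2).
  (* [Ordinal hn] is the index that makes the maximum well defined. *)
  case: (arg_maxP (fun i => x 0 i ^+ 2) (erefl : xpredT (Ordinal hn))).
  by move=> i _ imax; exists (x 0 i ^+ 2) => j; [exact: imax | exact: hx].
apply: snt_rank_le; rewrite (edm_dilation x r m).
apply: has_snt_add.
  apply: has_snt_congr; last exact: snt_rank_has (edm_symnneg x).
  by apply: col_mx_over; apply/mxOverP => i j;
    rewrite mxE nnegrE mulrn_wge0 // ltW.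
(* The inner dimension (1 + 1) + (1 + 1) computes to 4. The columns of [U] and [V] are nonnegative
   by [m_max], [r_ge1] and [m_min]. *)
apply: (@has_snt_antidiag _ _ _ (1 + 1)); apply: row_mx_over;
  apply/mxOverP => i j; rewrite mxE nnegrE //.
- by rewrite subr_ge0.
- by rewrite subr_ge0.
- by rewrite mulr_ge0 // subr_ge0.
Qed.
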